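(* For $s\geq 0$ let $(G_s,\varphi)$ be as in the context. Then: (i) $(G_s,\varphi)$ is a Laplacian soliton with constant $c_s=-\tfrac{15}{8}+8s^2$ and derivation $D_s=\tfrac1{32}\mathrm{Diag}(45-32s-64s^2,\,5-32s-64s^2,\,45+32s-64s^2,\,5+32s-64s^2,\,50-128s^2,\,90-128s^2,\,0)\in\mathrm{Der}(\mathfrak g_s)$ (diagonal in the basis $e_1,\dots,e_7$); consequently it is shrinking if $s\in[0,\tfrac{\sqrt{15}}8)$, steady if $s=\tfrac{\sqrt{15}}8$, and expanding if $s\in(\tfrac{\sqrt{15}}8,\infty)$. (ii) $(G_s,\langle\cdot,\cdot\rangle)$ is an expanding Ricci soliton if and only if $s=\tfrac58$. (iii) For all $a,s\in\mathbb R$, the Lie algebras $\mathfrak g_s$ and $\mathfrak s_a$ are not isomorphic.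
   Context: For $s\in\mathbb R$, $\mathfrak g_s$ is the real Lie algebra with basis $\{e_1,\dots,e_7\}$ whose only nonzero brackets of basis elements (up to antisymmetry) are $[e_1,e_3]=-e_6$, $[e_1,e_4]=-e_5$, $[e_2,e_3]=-e_5$, $[e_7,e_i]=(A_s)_{ii}e_i$ ($i=1,\dots,6$), with $A_s=\mathrm{Diag}(\tfrac38+s,-\tfrac18+s,\tfrac38-s,-\tfrac18-s,\tfrac14,\tfrac34)$; $G_s$ is the simply connected Lie group with Lie algebra $\mathfrak g_s$, with left-invariant $G_2$-structure $\varphi=e^{127}+e^{347}+e^{567}+e^{135}-e^{146}-e^{236}-e^{245}$ ($e^{ijk}=e^i\wedge e^j\wedge e^k$, $\{e^i\}$ dual basis). $\langle\cdot,\cdot\rangle$ is the left-invariant metric induced by $\varphi$, making $\{e_i\}$ orthonormal; $\Delta=dd^*+d^*d$ is the Hodge Laplacian of this metric (orientation $e^{1234567}$). For $a\in\mathbb R$, $\mathfrak s_a$ is the real Lie algebra with basis $\{e_1,\dots,e_7\}$ whose only nonzero brackets of basis elements (up to antisymmetry) are $[e_1,e_3]=-e_6$, $[e_1,e_4]=-e_5$, $[e_2,e_3]=-e_5$, $[e_2,e_4]=e_6$, $[e_7,e_i]=(A_a)_{ii}e_i$ ($i=1,\dots,6$), with $A_a=\tfrac14\mathrm{Diag}(1+4a,1+4a,1-4a,1-4a,2,2)$. For $D\in\mathrm{Der}(\mathfrak g)$ of the Lie algebra $\mathfrak g$ of a simply connected Lie group $G$, $X_D$ is the vector field $X_D(p)=\frac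 d{dt}|_{0}f_t(p)$, with $f_t\in\mathrm{Aut}(G)$ the automorphism satisfying $df_t|_e=e^{tD}$. A left-invariant $G_2$-structure $\varphi$ is a Laplacian soliton with constant $c\in\mathbb R$ and derivation $D$ if $\Delta\varphi=c\varphi+\mathcal L_{X_D}\varphi$ ($\mathcal L$ the Lie derivative); it is shrinking, steady or expanding if $c<0$, $c=0$ or $c>0$. A left-invariant metric $\langle\cdot,\cdot\rangle$ on $G$ is a Ricci soliton if its Ricci operator satisfies $\mathrm{Ric}=c\,\mathrm{id}+D$ for some $c\in\mathbb R$ and $D\in\mathrm{Der}(\mathfrak g)$; it is expanding if $c<0$. *)

(* Defs.v *)
From mathcomp Require Import all_boot all_order all_algebra.
From mathcomp Require Import reals.

Set Implicit Arguments.
Unset Strict Implicit.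
Unset Printing Implicit Defensive.

Import Order.TTheory GRing.Theory Num.Theory.
Local Open Scope ring_scope.

(* Left-invariant calculus on a 7-dimensional real Lie group, carried   *)
(* out on its Lie algebra R^7 (row vectors), with standard basis        *)
(* e_0..e_6 (= the paper's e_1..e_7), which is orthonormal for the      *)
(* metric considered, oriented by e^{1..7}.                            *)

Section LeftInv.
Variable R : realType.

Definition vec := 'rV[R]_7.

Definition ebase (i : 'I_7) : vec := delta_mx 0 i.

Definition ip (x y : vec) : R := \sum_(i < 7) x 0 i * y 0 i.

Definition bracket_of (T : 'I_7 -> 'I_7 -> vec) (x y : vec) : vec :=
  \sum_(i < 7) \sum_(j < 7) (x 0 i * y 0 j) *: T i j.

Definition is_derivation (br : vec -> vec -> vec) (D : 'M[R]_7) : Prop :=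
  forall x y : vec, br x y *m D = br (x *m D) y + br x (y *m D).

Definition lie_isomorphic (br1 br2 : vec -> vec -> vec) : Prop :=
  exists M : 'M[R]_7, M \in unitmx /\
    forall x y : vec, br1 x y *m M = br2 (x *m M) (y *m M).

(* Left-invariant differential forms = alternating multilinear forms on *)
(* the Lie algebra; a k-form is evaluated on a list of k vectors.        *)
Definition form := seq vec -> R.

(* exterior derivative of left-invariant forms (Chevalley-Eilenberg):   *)
(* (d a)(x_0..x_k) = sum_{i<j} (-1)^{i+j} a([x_i,x_j], x_0..^i..^j..x_k) *)
Definition drop2 (i j : nat) (xs : seq vec) : seq vec :=
  [seq nth 0 xs l | l <- iota 0 (size xs) & (l != i) && (l != j)].

Definition ext_d (br : vec -> vec -> vec) (a : form) : form :=
  fun xs => \sum_(i < size xs) \sum_(j < size xs | (i < j)%N)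
     (-1) ^+ (i + j) * a (br (nth 0 xs i) (nth 0 xs j) :: drop2 i j xs).

Definition vol (zs : seq vec) : R :=
  \det (\matrix_(i < 7, j < 7) (nth 0 zs i) 0 j).

Definition basis_seq (k : nat) (f : {ffun 'I_k -> 'I_7}) : seq vec :=
  [seq ebase (f i) | i <- enum 'I_k].

(* Hodge star of the metric/orientation: for a k-form a,               *)
(* ( *a)(y_1..y_{7-k}) = (1/k!) sum_{i_1..i_k} a(e_i..) vol(e_i.., y..)  *)
(* (characterized by a /\ *b = <a,b> vol).                              *)
Definition hodge (a : form) : form :=
  fun ys => let k := (7 - size ys)%N in
    (k`!%:R)^-1 * \sum_(f : {ffun 'I_k -> 'I_7})
                    a (basis_seq f) * vol (basis_seq f ++ ys).

(* codifferential on k-forms in dimension 7:                            *)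
(* d^* = (-1)^{n(k+1)+1} * d * = (-1)^k * d *                           *)
Definition codiff (br : vec -> vec -> vec) (k : nat) (a : form) : form :=
  fun xs => (-1) ^+ k * hodge (ext_d br (hodge a)) xs.

Definition hodge_laplacian (br : vec -> vec -> vec) (k : nat) (a : form)
  : form :=
  fun xs => ext_d br (codiff br k a) xs + codiff br k.+1 (ext_d br a) xs.

(* Lie derivative of a left-invariant form along X_D, D a derivation:   *)
(* L_{X_D} a = d/dt|_0 (e^{tD})^* a = sum_i a(.., D x_i, ..)             *)
Definition lie_deriv_XD (D : 'M[R]_7) (a : form) : form :=
  fun xs => \sum_(i < size xs) a (set_nth 0 xs i (nth 0 xs i *m D)).

Definition e3 (i j k : 'I_7) : form :=
  fun xs => \det (\matrix_(a < 3, b < 3) (nth 0 xs a) 0 (tnth [tuple i; j; k] b)).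

Definition laplacian_soliton (br : vec -> vec -> vec) (phi : form) (c : R)
  (D : 'M[R]_7) : Prop :=
  is_derivation br D /\
  forall x y z : vec,
    hodge_laplacian br 3 phi [:: x; y; z]
    = c * phi [:: x; y; z] + lie_deriv_XD D phi [:: x; y; z].

(* Levi-Civita connection of a left-invariant metric (Koszul formula)   *)
Definition lc_nabla (br : vec -> vec -> vec) (x y : vec) : vec :=
  \sum_(k < 7) (2^-1 * (ip (br x y) (ebase k) - ip (br y (ebase k)) x
                        + ip (br (ebase k) x) y)) *: ebase k.

Definition curv (br : vec -> vec -> vec) (x y z : vec) : vec :=
  lc_nabla br x (lc_nabla br y z) - lc_nabla br y (lc_nabla br x z)
  - lc_nabla br (br x y) z.

Definition ricci_tensor (br : vec -> vec -> vec) (y z : vec) : R :=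
  \sum_(i < 7) ip (curv br (ebase i) y z) (ebase i).

Definition ricci_op (br : vec -> vec -> vec) : 'M[R]_7 :=
  \matrix_(i < 7, j < 7) ricci_tensor br (ebase i) (ebase j).

Definition ricci_soliton_with (br : vec -> vec -> vec) (c : R) : Prop :=
  exists D : 'M[R]_7, is_derivation br D /\ ricci_op br = c%:M + D.

Definition expanding_ricci_soliton (br : vec -> vec -> vec) : Prop :=
  exists c : R, c < 0 /\ ricci_soliton_with br c.

(* The concrete data of the paper (0-based indices: e_1 = ebase 0, ...) *)

Definition Adiag_g (s : R) (i : nat) : R :=
  match i with
  | 0 => 3/8 + s | 1 => -1/8 + s | 2 => 3/8 - s | 3 => -1/8 - s
  | 4 => 1/4 | 5 => 3/4 | _ => 0 end.

Definition Adiag_s (a : R) (i : nat) : R :=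
  match i with
  | 0 => (1 + 4 * a) / 4 | 1 => (1 + 4 * a) / 4
  | 2 => (1 - 4 * a) / 4 | 3 => (1 - 4 * a) / 4
  | 4 => 2 / 4 | 5 => 2 / 4 | _ => 0 end.

Definition e_nat (n : nat) : vec := ebase (inord n).

Definition g_table (s : R) (i j : 'I_7) : vec :=
  match nat_of_ord i, nat_of_ord j with
  | 0, 2 => - e_nat 5 | 2, 0 => e_nat 5
  | 0, 3 => - e_nat 4 | 3, 0 => e_nat 4
  | 1, 2 => - e_nat 4 | 2, 1 => e_nat 4
  | 6, 6 => 0
  | 6, k => Adiag_g s k *: e_nat k
  | k, 6 => - (Adiag_g s k *: e_nat k)
  | _, _ => 0
  end.

Definition s_table (a : R) (i j : 'I_7) : vec :=
  match nat_of_ord i, nat_of_ord j with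
  | 0, 2 => - e_nat 5 | 2, 0 => e_nat 5
  | 0, 3 => - e_nat 4 | 3, 0 => e_nat 4
  | 1, 2 => - e_nat 4 | 2, 1 => e_nat 4
  | 1, 3 => e_nat 5 | 3, 1 => - e_nat 5
  | 6, 6 => 0
  | 6, k => Adiag_s a k *: e_nat k
  | k, 6 => - (Adiag_s a k *: e_nat k)
  | _, _ => 0
  end.

Definition br_g (s : R) : vec -> vec -> vec := bracket_of (g_table s).
Definition br_s (a : R) : vec -> vec -> vec := bracket_of (s_table a).

Definition phiG2 : form :=
  fun xs =>
    e3 (inord 0) (inord 1) (inord 6) xs + e3 (inord 2) (inord 3) (inord 6) xs
  + e3 (inord 4) (inord 5) (inord 6) xs + e3 (inord 0) (inord 2) (inord 4) xs
  - e3 (inord 0) (inord 3) (inord 5) xs - e3 (inord 1) (inord 2) (inord 5) xs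
  - e3 (inord 1) (inord 3) (inord 4) xs.

Definition c_sol (s : R) : R := -15/8 + 8 * s ^+ 2.

Definition D_sol (s : R) : 'M[R]_7 :=
  diag_mx (\row_(i < 7)
    ((match nat_of_ord i with
     | 0 => 45 - 32 * s - 64 * s ^+ 2
     | 1 => 5 - 32 * s - 64 * s ^+ 2
     | 2 => 45 + 32 * s - 64 * s ^+ 2
     | 3 => 5 + 32 * s - 64 * s ^+ 2
     | 4 => 50 - 128 * s ^+ 2
     | 5 => 90 - 128 * s ^+ 2
     | _ => 0 end) / 32)).

End LeftInv.

(* Main.v *)
Require Import Defs.
From Stdlib Require Import QArith.
From mathcomp Require Import all_boot all_order all_algebra.
From mathcomp Require Import reals.
From mathcomp Require Import ssrZ ring lra zify.
Import Order.TTheory GRing.Theory Num.Theory.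
Local Open Scope ring_scope.
Set Implicit Arguments.
Unset Strict Implicit.
Unset Printing Implicit Defensive.

(** All structure constants of [g_s] are polynomials in [s] with rational
    coefficients. A multilinear identity is determined by its values on basis
    vectors, where the Laplacian of [phi] and the Ricci tensor become finite
    computations in [Q[s]]; these are carried out on lists of coefficients and
    transported to [R] by evaluation at [s].

    The Ricci operator is diagonal, with entries [r_1, ..., r_7]. A derivation
    [Ric - c id] must kill [e_7], so [c = r_7], and the bracket [[e_1, e_3]]
    forces [r_1 + r_3 - r_6 - r_7 = 4 s^2 - 25/16] to vanish.

    For the last part, an isomorphism preserves the traces of the powers of
    adjoint maps. With [X] the image of [e_7], [tr (ad X ^ k)] depends only on
    the last coordinate [t] of [X], because [ad X] is triangular for a suitable
    grading. The traces for [k = 1, 2, 3] determine [t], [a^2] and [s^2], and the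
    one for [k = 4] is then contradictory. *)


(** * Polynomials with rational coefficients *)

Local Arguments Qred : simpl never.

(** Coefficients in increasing degree. Trailing zeros may remain, so vanishing is tested by [pisZ]
    and not by comparison with [[::]]. *)
Definition ratpoly := seq Q.

Fixpoint padd (p q : ratpoly) : ratpoly :=
  match p, q with
  | [::], _ => q
  | _, [::] => p
  | a :: p', b :: q' => Qred (Qplus a b) :: padd p' q'
  end.

Definition pscale (c : Q) (p : ratpoly) : ratpoly := [seq Qred (Qmult c a) | a <- p].

(** The case [q = [::]] keeps zero products empty instead of turning them into lists of zeros. *)
Definition pmul (p q : ratpoly) : ratpoly :=
  if q is [::] then [::]
  else foldr (fun a r => padd (pscale a q) (Qmake 0 1 :: r)) [::] p.

Definition psub (p q : ratpoly) : ratpoly := padd p (pscale (Qmake (-1) 1) q).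

Definition psum (ps : seq ratpoly) : ratpoly := foldr padd [::] ps.

Definition pisZ (p : ratpoly) : bool := all (fun a => Qeq_bool a (Qmake 0 1)) p.

Definition pconst (c : Q) : ratpoly := [:: c].

Definition psign (b : bool) (p : ratpoly) : ratpoly :=
  if b then pscale (Qmake (-1) 1) p else p.

Definition pdelta (i j : nat) : ratpoly := if i == j then pconst (Qmake 1 1) else [::].

(** * Evaluation of rational polynomials at a real number *)

Section Eval.
Variables (R : realType) (s : R).

Definition Z2R (z : Z) : R := (int_of_Z z)%:~R.

Definition Q2R (q : Q) : R := Z2R (Qnum q) / Z2R (Zpos (Qden q)).

Definition pev (p : ratpoly) : R := foldr (fun a v => Q2R a + s * v) 0 p.

Lemma Z2RD x y : Z2R (x + y)%Z = Z2R x + Z2R y.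
Proof. by rewrite /Z2R (raddfD int_of_Z) rmorphD. Qed.

Lemma Z2RM x y : Z2R (x * y)%Z = Z2R x * Z2R y.
Proof. by rewrite /Z2R (rmorphM int_of_Z) rmorphM. Qed.

Lemma Z2R_pos_neq0 p : Z2R (Zpos p) != 0.
Proof.
rewrite /Z2R intr_eq0; apply/eqP => h.
by have := int_of_ZK (Zpos p); rewrite h.
Qed.

Lemma Q2R_eq p q : Qeq p q -> Q2R p = Q2R q.
Proof.
move=> /(congr1 Z2R); rewrite !Z2RM => h; apply/eqP.
by rewrite eqr_div ?Z2R_pos_neq0 // h.
Qed.

Lemma Q2R_red q : Q2R (Qred q) = Q2R q.
Proof. exact: Q2R_eq (Qred_correct q). Qed.

Lemma Q2RD p q : Q2R (Qplus p q) = Q2R p + Q2R q.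
Proof.
rewrite /Q2R /= Pos2Z.inj_mul Z2RD !Z2RM.
by field; rewrite !Z2R_pos_neq0.
Qed.

Lemma Q2RM p q : Q2R (Qmult p q) = Q2R p * Q2R q.
Proof.
rewrite /Q2R /= Pos2Z.inj_mul !Z2RM.
by field; rewrite !Z2R_pos_neq0.
Qed.

Lemma Q2R0 : Q2R (Qmake 0 1) = 0.
Proof. by rewrite /Q2R /Z2R /= mul0r. Qed.

Lemma Q2R1 : Q2R (Qmake 1 1) = 1.
Proof. by rewrite /Q2R /Z2R /= divr1. Qed.

Lemma Q2RN1 : Q2R (Qmake (-1) 1) = -1.
Proof. by rewrite /Q2R /Z2R /= divr1. Qed.

Lemma pevD p q : pev (padd p q) = pev p + pev q.
Proof.
elim: p q => [|a p IH] [|b q] /=; rewrite ?add0r ?addr0 //.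
by rewrite IH Q2R_red Q2RD; ring.
Qed.

Lemma pevZ c p : pev (pscale c p) = Q2R c * pev p.
Proof.
elim: p => [|a p IH] /=; rewrite ?mulr0 //.
by rewrite IH Q2R_red Q2RM; ring.
Qed.

Lemma pevM p q : pev (pmul p q) = pev p * pev q.
Proof.
rewrite /pmul; case Eq: q => [|b q']; first by rewrite mulr0.
rewrite -Eq; elim: p => [|a p IH] /=; first by rewrite mul0r.
by rewrite pevD pevZ /= IH Q2R0; ring.
Qed.

Lemma pevB p q : pev (psub p q) = pev p - pev q.
Proof. by rewrite pevD pevZ Q2RN1 mulN1r. Qed.

Lemma pev_sum (I : Type) (r : seq I) (F : I -> ratpoly) :
  pev (psum [seq F i | i <- r]) = \sum_(i <- r) pev (F i).
Proof. by elim: r => [|i r IH] /=; rewrite ?big_nil // big_cons pevD IH. Qed.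

Lemma pev_isZ p : pisZ p -> pev p = 0.
Proof.
elim: p => //= a p IH /andP[/Qeq_bool_eq ha /IH ->].
by rewrite (Q2R_eq ha) Q2R0 mulr0 addr0.
Qed.

Lemma pev_const c : pev (pconst c) = Q2R c.
Proof. by rewrite /= mulr0 addr0. Qed.

Lemma pev_sign b p : pev (psign b p) = (-1) ^+ b * pev p.
Proof. by case: b; rewrite /= ?pevZ ?Q2RN1 ?expr1 ?expr0 ?mul1r. Qed.

Lemma pev_delta i j : pev (pdelta i j) = (i == j)%:R.
Proof. by rewrite /pdelta; case: eqP => _ //; rewrite pev_const Q2R1. Qed.

End Eval.


(** * Brackets in coordinates *)

Section Coord.
Variable R : realType.
Implicit Types (x y v : vec R) (f : vec R -> R).

(** Natural number indices let a case analysis on [n < 7] reduce vector identities to seven ring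
    identities. Out of range, [inord] falls back to index 0, whence the bounds below. *)
Definition co x (n : nat) : R := x 0 (inord n).

Lemma co_ord x (i : 'I_7) : x 0 i = co x i.
Proof. by rewrite /co inord_val. Qed.

Lemma vec_eq x y : (forall n, (n < 7)%N -> co x n = co y n) -> x = y.
Proof. by move=> h; apply/rowP => i; rewrite !co_ord h. Qed.

Lemma coD x y n : co (x + y) n = co x n + co y n.
Proof. by rewrite /co mxE. Qed.

Lemma coN x n : co (- x) n = - co x n.
Proof. by rewrite /co mxE. Qed.

Lemma coZ c x n : co (c *: x) n = c * co x n.
Proof. by rewrite /co mxE. Qed.

Lemma co0 n : co (0 : vec R) n = 0.
Proof. by rewrite /co mxE. Qed.

Lemma co_e_nat m n : (m < 7)%N -> (n < 7)%N -> co (e_nat R m) n = (m == n)%:R.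
Proof.
move=> hm hn; rewrite /co /e_nat /ebase mxE eqxx /=; congr (nat_of_bool _)%:R.
by rewrite -val_eqE /= !inordK // eq_sym.
Qed.

Lemma e_nat_ord (i : 'I_7) : e_nat R i = ebase R i.
Proof. by rewrite /e_nat inord_val. Qed.

Lemma sum_ord7 (V : nmodType) (F : 'I_7 -> V) :
  \sum_(i < 7) F i = F (inord 0) + F (inord 1) + F (inord 2) + F (inord 3)
    + F (inord 4) + F (inord 5) + F (inord 6).
Proof.
under eq_bigr do rewrite -[X in F X]inord_val.
by rewrite !big_ord_recl big_ord0 /= addr0 !addrA.
Qed.

Lemma co_bracket_of T x y n :
  co (bracket_of T x y) n = \sum_(i < 7) \sum_(j < 7) co x i * co y j * co (T i j) n.
Proof.
rewrite /co /bracket_of summxE; apply: eq_bigr => i _.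
by rewrite summxE; apply: eq_bigr => j _; rewrite !mxE !inord_val.
Qed.

Definition brg_coords (s : R) (x y : nat -> R) : seq R :=
  let w n := Adiag_g s n * (x 6%N * y n - x n * y 6%N) in
  [:: w 0%N; w 1%N; w 2%N; w 3%N;
      w 4%N - (x 0%N * y 3%N - x 3%N * y 0%N) - (x 1%N * y 2%N - x 2%N * y 1%N);
      w 5%N - (x 0%N * y 2%N - x 2%N * y 0%N); 0].

Definition brs_coords (a : R) (x y : nat -> R) : seq R :=
  let w n := Adiag_s a n * (x 6%N * y n - x n * y 6%N) in
  [:: w 0%N; w 1%N; w 2%N; w 3%N;
      w 4%N - (x 0%N * y 3%N - x 3%N * y 0%N) - (x 1%N * y 2%N - x 2%N * y 1%N);
      w 5%N - (x 0%N * y 2%N - x 2%N * y 0%N) + (x 1%N * y 3%N - x 3%N * y 1%N); 0].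

Lemma co_br_g s x y n : (n < 7)%N ->
  co (br_g s x y) n = nth 0 (brg_coords s (co x) (co y)) n.
Proof.
move=> hn; rewrite co_bracket_of !sum_ord7 /g_table !inordK //.
rewrite !(coD, coN, coZ, co0) !co_e_nat // /brg_coords.
by move: n hn; do 7 (case; [move=> _ /=; ring | ]).
Qed.

Lemma co_br_s a x y n : (n < 7)%N ->
  co (br_s a x y) n = nth 0 (brs_coords a (co x) (co y)) n.
Proof.
move=> hn; rewrite co_bracket_of !sum_ord7 /s_table !inordK //.
rewrite !(coD, coN, coZ, co0) !co_e_nat // /brs_coords.
by move: n hn; do 7 (case; [move=> _ /=; ring | ]).
Qed.

End Coord.


(** * Diagonal derivations of [g_s] *)

Section Derivations.
Variables (R : realType) (s : R).
Implicit Types (x y d : vec R).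

Lemma co_mul_diag x d n : co (x *m diag_mx d) n = co x n * co d n.
Proof. by rewrite /co mul_mx_diag mxE. Qed.

(** A diagonal map is a derivation once its eigenvalues add up along each nonzero bracket of basis
    vectors; for $[e_7, e_i]$ this means that the eigenvalue on $e_7$ is 0. *)
Lemma diag_derivation_br_g d :
  co d 6 = 0 -> co d 0 + co d 2 = co d 5 -> co d 0 + co d 3 = co d 4 ->
  co d 1 + co d 2 = co d 4 -> is_derivation (br_g s) (diag_mx d).
Proof.
move=> h6 h5 h4 h4' x y; apply: vec_eq => n hn.
rewrite co_mul_diag coD !co_br_g // /brg_coords.
rewrite !co_mul_diag h6 -h5.
have h1 : co d 1 = co d 0 + co d 3 - co d 2 by rewrite h4 -h4' addrK.
move: n hn; do 7 (case; [move=> _ /=; rewrite ?h1 ?h6 -?h5 -?h4; ring | ]).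
by [].
Qed.

Lemma br_g_diag_derivation d : is_derivation (br_g s) (diag_mx d) ->
  co d 6 = 0 /\ co d 0 + co d 2 = co d 5.
Proof.
move=> hd; split.
  (* The bracket $[e_7, e_5] = e_5/4$ has a nonzero coefficient whatever [s] is. *)
  have /(congr1 (fun v => co v 4)) := hd (e_nat R 6) (e_nat R 4).
  rewrite co_mul_diag coD !co_br_g // /= !co_mul_diag !co_e_nat //= => h.
  by lra.
have /(congr1 (fun v => co v 5)) := hd (e_nat R 0) (e_nat R 2).
rewrite co_mul_diag coD !co_br_g // /= !co_mul_diag !co_e_nat //= => h.
by lra.
Qed.

End Derivations.

(** * Traces of powers of adjoint maps *)

Section HeightTriangular.
Variables (R : comNzRingType) (n : nat) (h : 'I_n.+1 -> nat).
Implicit Types A B : 'M[R]_n.+1.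

(** With row vectors, [A i j] is the coefficient of $e_j$ in the image of $e_i$: apart from its
    diagonal part, [A] strictly raises the height. *)
Definition height_trig A : Prop :=
  forall i j, i != j -> (h j <= h i)%N -> A i j = 0.

Lemma height_trigM A B : height_trig A -> height_trig B -> height_trig (A *m B).
Proof.
move=> hA hB i j nij hji; rewrite mxE big1 // => k _.
have [Eik|nik] := eqVneq i k.
  by rewrite -Eik (hB i j) // mulr0.
have [hki|hik] := leqP (h k) (h i); first by rewrite hA // mul0r.
have [Ekj|nkj] := eqVneq k j.
  by rewrite Ekj ltnNge hji in hik.
by rewrite (hB k j) ?mulr0 // (leq_trans hji) // ltnW.
Qed.

Lemma height_trig_diagM A B i :
  height_trig A -> height_trig B -> (A *m B) i i = A i i * B i i.
Proof.
move=> hA hB; rewrite mxE (bigD1 i) //= big1 ?addr0 // => k nki.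
have [hki|hik] := leqP (h k) (h i); first by rewrite hA ?mul0r // eq_sym.
by rewrite hB ?mulr0 // ltnW.
Qed.

Lemma height_trigX A k : height_trig A -> height_trig (A ^+ k).
Proof.
move=> hA; elim: k => [|k IH]; last by rewrite exprS; apply: height_trigM.
by move=> i j /negPf nij _; rewrite expr0 mxE nij.
Qed.

Lemma height_trig_traceX A k :
  height_trig A -> \tr (A ^+ k) = \sum_i A i i ^+ k.
Proof.
move=> hA; apply: eq_bigr => i _; elim: k => [|k IH].
  by rewrite !expr0 mxE eqxx.
by rewrite !exprS height_trig_diagM ?IH //; apply: height_trigX.
Qed.

End HeightTriangular.

(** * Trace invariants separating [g_s] from [s_a] *)

Section NonIsomorphism.
Variable R : realType.
Implicit Types (x y : vec R) (T : 'I_7 -> 'I_7 -> vec R).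

Definition ad_mx T x : 'M[R]_7 :=
  \matrix_(j < 7) bracket_of T x (ebase R j).

Lemma ad_mxE T x y : bracket_of T x y = y *m ad_mx T x.
Proof.
apply/rowP => n; rewrite mxE co_ord co_bracket_of exchange_big.
apply: eq_bigr => j _; rewrite !mxE co_ord co_bracket_of -co_ord mulr_sumr.
apply: eq_bigr => i _; rewrite (bigD1 j) //= big1 => [|k /negPf nkj].
  by rewrite -(co_ord (ebase R j)) mxE !eqxx -!co_ord /= mulr1 addr0 mulrCA mulrA.
by rewrite -(co_ord (ebase R j)) mxE nkj /= mulr0 mul0r.
Qed.

(** An isomorphism conjugates the adjoint map of [x] into that of its image, hence also their
    powers, and the trace is invariant under conjugation. *)
Lemma isomorphism_ad_trace T1 T2 (M : 'M[R]_7) x k : M \in unitmx ->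
  (forall u v, bracket_of T1 u v *m M = bracket_of T2 (u *m M) (v *m M)) ->
  \tr (ad_mx T1 x ^+ k) = \tr (ad_mx T2 (x *m M) ^+ k).
Proof.
move=> uM hM; set A := ad_mx T1 x; set B := ad_mx T2 _.
have AB : A *m M = M *m B.
  apply/row_matrixP => i; rewrite !rowE !mulmxA.
  by rewrite -!ad_mxE hM.
have ABk : A ^+ k *m M = M *m B ^+ k.
  elim: k => [|k IH]; first by rewrite !expr0 mul1mx mulmx1.
  by rewrite !exprSr -!mulmxE -mulmxA AB mulmxA IH -mulmxA.
by rewrite -[A ^+ k]mulmx1 -(mulmxV uM) mulmxA ABk mxtrace_mulC mulmxA mulVmx // mul1mx.
Qed.

(** A grading of both Lie algebras: $e_7$ has degree 0, $e_1, \dots, e_4$ degree 1, $e_5$ and $e_6$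
    degree 2. The only element of degree 0 acts diagonally, and the others raise the degree. *)
Definition height (i : 'I_7) : nat := nth 0 [:: 1; 1; 1; 1; 2; 2; 0]%N i.

Lemma ad_mx_co T x (i j : 'I_7) : ad_mx T x i j = co (bracket_of T x (e_nat R i)) j.
Proof. by rewrite mxE e_nat_ord co_ord. Qed.

Lemma ad_g_height_trig s x : height_trig height (ad_mx (g_table s) x).
Proof.
move=> i j; rewrite ad_mx_co -/(br_g s) co_br_g // -val_eqE /height /brg_coords.
case: i => i hi; case: j => j hj /=; rewrite !co_e_nat //.
by move: i hi j hj;
  do 7 (case; [by move=> _; do 7 (case; [move=> _ //= _ _; ring | ]) | ]).
Qed.

Lemma ad_s_height_trig a x : height_trig height (ad_mx (s_table a) x).
Proof.
move=> i j; rewrite ad_mx_co -/(br_s a) co_br_s // -val_eqE /height /brs_coords.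
case: i => i hi; case: j => j hj /=; rewrite !co_e_nat //.
by move: i hi j hj;
  do 7 (case; [by move=> _; do 7 (case; [move=> _ //= _ _; ring | ]) | ]).
Qed.

Lemma ad_g_diag s x (i : 'I_7) :
  ad_mx (g_table s) x i i = co x 6 * Adiag_g s i.
Proof.
rewrite ad_mx_co -/(br_g s) co_br_g // /brg_coords.
case: i => i hi /=; rewrite !co_e_nat //.
by move: i hi; do 7 (case; [move=> _ /=; ring | ]).
Qed.

Lemma ad_s_diag a x (i : 'I_7) :
  ad_mx (s_table a) x i i = co x 6 * Adiag_s a i.
Proof.
rewrite ad_mx_co -/(br_s a) co_br_s // /brs_coords.
case: i => i hi /=; rewrite !co_e_nat //.
by move: i hi; do 7 (case; [move=> _ /=; ring | ]).
Qed.

Lemma g_s_not_isomorphic (a s : R) : ~ lie_isomorphic (br_g s) (br_s a).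
Proof.
case=> M [uM hM]; set x := e_nat R 6 *m M.
have tr k : \sum_(i < 7) Adiag_g s i ^+ k = \sum_(i < 7) (co x 6 * Adiag_s a i) ^+ k.
  have := isomorphism_ad_trace (e_nat R 6) k uM hM.
  rewrite (height_trig_traceX _ (@ad_g_height_trig _ _)).
  rewrite (height_trig_traceX _ (@ad_s_height_trig _ _)).
  under eq_bigr do rewrite ad_g_diag co_e_nat // mul1r.
  by under [in X in _ = X -> _]eq_bigr do rewrite ad_s_diag.
have := tr 1%N; have := tr 2%N; have := tr 3%N; have := tr 4%N.
rewrite !sum_ord7 !inordK //=; set t := co x 6.
move=> p4 p3 p2 p1.
(* For [k = 1] the traces are $3/2$ and $2t$. The parameters enter in pairs $\pm s$ and $\pm a$, so
   only even powers survive: [k = 2] expresses $a^2$ by $s^2$, and [k = 3] then fixes $s^2$. *)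
have tE : t = 3 / 4 by lra.
rewrite tE in p2 p3 p4.
have a2 : a ^+ 2 = 11 / 48 + 16 / 9 * s ^+ 2 by lra.
have s2 : s ^+ 2 = 5 / 32 by lra.
have s4 : s ^+ 4 = 25 / 1024 by rewrite (exprM s 2 2) s2; field.
have a4 : a ^+ 4 = (73 / 144) ^+ 2 by rewrite (exprM a 2 2) a2 s2; field.
have {}a2 : a ^+ 2 = 73 / 144 by rewrite a2 s2; field.
lra.
Qed.

End NonIsomorphism.


(** * Vectors with polynomial coordinates *)

Definition pvec := seq ratpoly.

Definition pco (x : pvec) (n : nat) : ratpoly := nth [::] x n.

Definition pmkvec (F : nat -> ratpoly) : pvec := mkseq F 7.

Definition pbase (i : nat) : pvec := pmkvec (pdelta i).

Definition pA (n : nat) : ratpoly :=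
  pco [:: [:: 3#8; 1#1]; [:: (-1)#8; 1#1]; [:: 3#8; (-1)#1]; [:: (-1)#8; (-1)#1];
          [:: 1#4]; [:: 3#4]]%Q n.

Definition pbr (x y : pvec) : pvec :=
  let m i j := psub (pmul (pco x i) (pco y j)) (pmul (pco x j) (pco y i)) in
  let w n := pmul (pA n) (m 6%N n) in
  [:: w 0%N; w 1%N; w 2%N; w 3%N;
      psub (psub (w 4%N) (m 0%N 3%N)) (m 1%N 2%N);
      psub (w 5%N) (m 0%N 2%N); [::]].

Definition pip (x y : pvec) : ratpoly :=
  psum [seq pmul (pco x i) (pco y i) | i <- iota 0 7].

Definition pnabla (x y : pvec) : pvec :=
  let xy := pbr x y in
  pmkvec (fun k => pscale (1#2)%Q
    (padd (psub (pco xy k) (pip (pbr y (pbase k)) x)) (pip (pbr (pbase k) x) y))).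

Definition pvsub (x y : pvec) : pvec := pmkvec (fun k => psub (pco x k) (pco y k)).

Definition pcurv (x y z : pvec) : pvec :=
  pvsub (pvsub (pnabla x (pnabla y z)) (pnabla y (pnabla x z))) (pnabla (pbr x y) z).

Definition pricci (y z : pvec) : ratpoly :=
  psum [seq pco (pcurv (pbase i) y z) i | i <- iota 0 7].

(** The expected Ricci eigenvalues; the last one is $-\mathrm{tr}(A_s^2)$. *)
Definition pricci_diag (n : nat) : ratpoly :=
  pco [:: [:: (-25)#16; (-3)#2]; [:: (-5)#16; (-3)#2]; [:: (-25)#16; 3#2];
          [:: (-5)#16; 3#2]; [:: 5#8]; [:: (-5)#8]; [:: (-15)#16; 0#1; (-4)#1]]%Q n.

Lemma all_iotaP (P : pred nat) n :
  all P (iota 0 n) -> forall i, (i < n)%N -> P i.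
Proof. by move=> /allP h i hi; apply: h; rewrite mem_iota. Qed.

Lemma pricciE i j : (i < 7)%N -> (j < 7)%N ->
  pisZ (psub (pricci (pbase i) (pbase j)) (pmul (pdelta i j) (pricci_diag i))).
Proof.
move=> hi hj; move: j hj; apply: all_iotaP; move: i hi; apply: all_iotaP.
by vm_compute.
Qed.

(** * Transport of the curvature computation to real vectors *)

Section Model.
Variables (R : realType) (s : R).
Implicit Types (x y z : vec R) (p q r : pvec).

(** Bracket, connection and curvature preserve this relation, so one computation in $\mathbb Q[s]$
    is valid at every real [s]. *)
Definition models x p : Prop := forall n, (n < 7)%N -> co x n = pev s (pco p n).

Lemma pco_mkvec F n : (n < 7)%N -> pco (pmkvec F) n = F n.
Proof. exact: nth_mkseq. Qed.

Lemma models_base n : (n < 7)%N -> models (e_nat R n) (pbase n).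
Proof. by move=> hn k hk; rewrite co_e_nat // pco_mkvec // pev_delta. Qed.

Lemma pev_pA n : pev s (pA n) = Adiag_g s n.
Proof.
do 6 (case: n => [|n]; first by rewrite /= /Q2R /Z2R /= /Pos.to_nat /=; field).
by case: n.
Qed.

Lemma models_br x y p q : models x p -> models y q -> models (br_g s x y) (pbr p q).
Proof.
move=> hx hy n hn; rewrite co_br_g // /brg_coords !hx // !hy //.
rewrite -[RHS](nth_map _ 0) // /pbr !map_cons !pevB !pevM !pevB !pevM !pev_pA.
by [].
Qed.

Lemma ip_models x y p q : models x p -> models y q -> ip x y = pev s (pip p q).
Proof.
move=> hx hy; rewrite /pip pev_sum -[iota 0 7]/(index_iota 0 7) big_mkord.
by apply: eq_bigr => i _; rewrite pevM -hx // -hy // !co_ord.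
Qed.

Lemma ip_ebase x (i : 'I_7) : ip x (ebase R i) = co x i.
Proof.
rewrite /ip (bigD1 i) //= big1 => [|j /negPf nji]; last by rewrite mxE nji mulr0.
by rewrite mxE !eqxx mulr1 addr0 co_ord.
Qed.

Lemma co_lc_nabla x y n : (n < 7)%N ->
  co (lc_nabla (br_g s) x y) n = 2^-1 * (co (br_g s x y) n
    - ip (br_g s y (e_nat R n)) x + ip (br_g s (e_nat R n) x) y).
Proof.
move=> hn; rewrite /co /lc_nabla summxE (bigD1 (inord n)) //= big1.
  by rewrite addr0 !mxE !eqxx mulr1 ip_ebase inordK.
by move=> i ni; rewrite !mxE eq_sym (negPf ni) mulr0.
Qed.

Lemma models_nabla x y p q :
  models x p -> models y q -> models (lc_nabla (br_g s) x y) (pnabla p q).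
Proof.
move=> hx hy n hn; have hb := models_base hn.
rewrite co_lc_nabla // pco_mkvec // pevZ pevD pevB.
rewrite -(models_br hx hy) // -(ip_models (models_br hy hb) hx).
rewrite -(ip_models (models_br hb hx) hy); congr (_ * _).
by rewrite /Q2R /Z2R /= /Pos.to_nat /=; field.
Qed.

Lemma models_sub x y p q : models x p -> models y q -> models (x - y) (pvsub p q).
Proof. by move=> hx hy n hn; rewrite pco_mkvec // pevB coD coN hx // hy. Qed.

Lemma models_curv x y z p q r : models x p -> models y q -> models z r ->
  models (curv (br_g s) x y z) (pcurv p q r).
Proof.
move=> hx hy hz; rewrite /curv /pcurv.
by do 2?[apply: models_sub]; do 2?[apply: models_nabla => //]; apply: models_br.
Qed.

Lemma ricci_tensor_models y z q r : models y q -> models z r ->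
  ricci_tensor (br_g s) y z = pev s (pricci q r).
Proof.
move=> hy hz; rewrite /pricci pev_sum -[iota 0 7]/(index_iota 0 7) big_mkord.
apply: eq_bigr => i _; rewrite ip_ebase -e_nat_ord.
by rewrite (models_curv (models_base _) hy hz).
Qed.

Definition ricci_diag : vec R := \row_n pev s (pricci_diag n).

Lemma ricci_op_br_g : ricci_op (br_g s) = diag_mx ricci_diag.
Proof.
apply/matrixP => i j; rewrite !mxE -!e_nat_ord.
rewrite (ricci_tensor_models (models_base _) (models_base _)) //.
have /(pev_isZ s) := pricciE (ltn_ord i) (ltn_ord j).
rewrite pevB pevM pev_delta => /eqP; rewrite subr_eq0 => /eqP ->.
by rewrite val_eqE; case: eqP => _; rewrite ?mul1r ?mul0r.
Qed.

Lemma expanding_ricci_soliton_br_g :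
  0 <= s -> expanding_ricci_soliton (br_g s) <-> s = 5 / 8.
Proof.
move=> s0.
have rE n : (n < 7)%N -> co ricci_diag n =
    nth 0 [:: -25/16 - 3/2 * s; -5/16 - 3/2 * s; -25/16 + 3/2 * s;
              -5/16 + 3/2 * s; 5/8; -5/8; -15/16 - 4 * s ^+ 2] n.
  move=> hn; rewrite /co mxE inordK //.
  by move: n hn;
    do 7 (case; [by rewrite /= /Q2R /Z2R /= /Pos.to_nat /= => _; field | ]).
have dE c : ricci_op (br_g s) - c%:M = diag_mx (ricci_diag - const_mx c).
  by rewrite ricci_op_br_g linearB /= diag_const_mx.
have cE c n : co (ricci_diag - const_mx c) n = co ricci_diag n - c.
  by rewrite coD coN /co !mxE.
split.
  case=> c [c0 [D [hD hric]]].
  have : is_derivation (br_g s) (diag_mx (ricci_diag - const_mx c)).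
    by rewrite -dE hric addrAC subrr add0r.
  move/br_g_diag_derivation; rewrite !cE !rE //= => -[h6 h5].
  (* Eliminating [c] between the two equations leaves four times this product; [s0] excludes the
     negative root. *)
  have : (s - 5 / 8) * (s + 5 / 8) = 0 by lra.
  move/eqP; rewrite mulf_eq0 => /orP[] /eqP; lra.
(* The constant must be the eigenvalue on $e_7$, which at $s = 5/8$ is $-15/16 - 25/16 = -5/2$. *)
move=> sE; exists (- (5 / 2)); split; first by lra.
exists (diag_mx (ricci_diag - const_mx (- (5 / 2)))); split.
  apply: diag_derivation_br_g; rewrite !cE !rE //= sE; by field.
by rewrite -dE addrC subrK.
Qed.

End Model.


(** * Forms given by their values on basis vectors *)

Definition iform := seq nat -> ratpoly.

Definition idrop2 (i j : nat) (l : seq nat) : seq nat :=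
  [seq nth 0%N l k | k <- iota 0 (size l) & (k != i) && (k != j)].

(** Each bracket is expanded in the basis, so that [c] is only evaluated on basis vectors;
    coefficients that are the empty list are skipped to save such evaluations. *)
Definition pext_d (c : iform) : iform := fun l =>
  psum [seq psum [seq psign (odd (i + j))
      (let v := pbr (pbase (nth 0%N l i)) (pbase (nth 0%N l j)) in
       psum [seq (if nilp (pco v m) then [::]
                  else pmul (pco v m) (c (m :: idrop2 i j l))) | m <- iota 0 7])
    | j <- iota 0 (size l) & (i < j)%N] | i <- iota 0 (size l)].

(* The sign of the permutation [l] of [0 .. n-1], by expansion of its matrix
   along the first row. *)
Fixpoint parity (n : nat) (l : seq nat) : bool :=
  match n, l with
  | n'.+1, i :: l' => odd i (+) parity n' [seq unbump i m | m <- l']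
  | _, _ => false
  end.

(* Sum over the [k] remaining indices of the argument of [c], [p] being those
   already chosen; repeated indices are skipped since the volume form vanishes. *)
Fixpoint phodge_rec (k : nat) (p : seq nat) (c : iform) (l : seq nat) : ratpoly :=
  if k is k'.+1 then
    psum [seq phodge_rec k' (rcons p i) c l | i <- iota 0 7 & i \notin p ++ l]
  else psign (parity 7 (p ++ l)) (c p).

Definition phodge (c : iform) : iform := fun l =>
  if uniq l then
    pscale (Qmake 1 (Pos.of_nat (7 - size l)`!)) (phodge_rec (7 - size l) [::] c l)
  else [::].

(* Extensionally [c] on valid lists; call-by-value evaluation of [memo k c]
   tabulates [c] once for all. *)
Fixpoint memo (k : nat) (c : iform) : iform :=
  if k is k'.+1 then
    let t := [seq memo k' (fun l => c (i :: l)) | i <- iota 0 7] in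
    fun l => nth (fun _ => [::]) t (head 0%N l) (behead l)
  else let v := c [::] in fun _ => v.

Definition valid (k : nat) (l : seq nat) : bool :=
  (size l == k) && all (fun i => i < 7)%N l.

Lemma memoE k c l : valid k l -> memo k c l = c l.
Proof.
elim: k c l => [|k IH] c [|i l] // /andP[sl] /andP[hi hl].
rewrite -[LHS]/(nth (fun _ => [::])
  [seq memo k (fun l => c (j :: l)) | j <- iota 0 7] i l).
rewrite (nth_map 0%N) ?size_iota // nth_iota // add0n IH //.
by rewrite /valid -eqSS sl.
Qed.

(** * The volume form on basis vectors *)

Section Determinants.
Variable R : realType.
Implicit Types (xs ys : seq (vec R)) (l : seq nat).

(** The first row has its only 1 in column [i]. Deleting that column renumbers the others by
    [unbump i], so the minor is again the matrix of a list without repetition. *)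
Lemma det_parity n l : size l = n -> all (fun i => i < n)%N l -> uniq l ->
  \det (\matrix_(i < n, j < n) (nth 0%N l i == j)%:R) = (-1) ^+ parity n l :> R.
Proof.
elim: n l => [|n IH] [|i l] //=; first by rewrite det_mx00 expr0.
move=> [sl] /andP[hi hl] /andP[nil ul].
rewrite (expand_det_row _ ord0) (bigD1 (Ordinal hi)) //= big1 => [|j]; last first.
  by rewrite -val_eqE /= => /negPf nji; rewrite mxE /= eq_sym nji mul0r.
rewrite mxE /= eqxx mul1r addr0 /cofactor /= add0n.
have mlt m : m \in l -> m != i.
  by apply: contraTneq => ->.
rewrite signr_addb signr_odd; congr (_ * _).
rewrite -IH ?size_map //; last 2 first.
- rewrite all_map; apply/allP => m hm /=.
  by move: (mlt m hm) (allP hl m hm); rewrite /unbump; lia.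
- rewrite map_inj_in_uniq // => m p hm hp.
  by move: (mlt m hm) (mlt p hp); rewrite /unbump; lia.
congr (\det _); apply/matrixP => a b; rewrite !mxE /=.
rewrite (nth_map 0%N) ?sl //; congr (nat_of_bool _)%:R.
have ha : nth 0%N l a \in l by rewrite mem_nth ?sl.
by rewrite -{1}(unbumpK (mlt _ ha)) (can_eq (bumpK i)).
Qed.

Lemma vol_dup (zs : seq (vec R)) : size zs = 7 -> ~~ uniq zs -> vol zs = 0.
Proof.
move=> sz /(uniqPn 0)[i [j [ij js e]]].
have js7 : (j < 7)%N by move: js; rewrite sz.
have is7 : (i < 7)%N by apply: ltn_trans js7.
apply: (@determinant_alternate _ _ _ (Ordinal is7) (Ordinal js7)).
  by rewrite -val_eqE /= neq_ltn ij.
by move=> k; rewrite !mxE /= e.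
Qed.

End Determinants.

(** * Linearity in one argument *)

Section Linear.
Variable R : realType.
Implicit Types (f g : vec R -> R) (xs ys : seq (vec R)).

Definition lin f : Prop := forall c u v, f (c *: u + v) = c * f u + f v.

Lemma lin_sum f n (c : 'I_n -> R) (u : 'I_n -> vec R) : lin f ->
  f (\sum_i c i *: u i) = \sum_i c i * f (u i).
Proof.
move=> lf; have f0 : f 0 = 0.
  by have := lf (-1) 0 0; rewrite scaler0 addr0 mulN1r addNr.
by elim/big_rec2: _ => // i x y _ <-; rewrite lf.
Qed.

Lemma lin_expand f v : lin f -> f v = \sum_(i < 7) v 0 i * f (ebase R i).
Proof. by move=> lf; rewrite {1}[v]row_sum_delta (lin_sum _ _ lf). Qed.

Lemma lin_basis0 f : lin f -> (forall i : 'I_7, f (ebase R i) = 0) -> forall v, f v = 0.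
Proof. by move=> lf h v; rewrite lin_expand // big1 // => i _; rewrite h mulr0. Qed.

Lemma eq_lin f g : f =1 g -> lin g -> lin f.
Proof. by move=> fg lg c u v; rewrite !fg lg. Qed.

Lemma linD f g : lin f -> lin g -> lin (fun v => f v + g v).
Proof. by move=> lf lg c u v; rewrite lf lg; ring. Qed.

Lemma linN f : lin f -> lin (fun v => - f v).
Proof. by move=> lf c u v; rewrite lf; ring. Qed.

Lemma linZ a f : lin f -> lin (fun v => a * f v).
Proof. by move=> lf c u v; rewrite lf; ring. Qed.

Lemma lin_comp_mulmx f (D : 'M_7) : lin f -> lin (fun v => f (v *m D)).
Proof. by move=> lf c u v; rewrite mulmxDl -scalemxAl lf. Qed.

Lemma br_g_linl (s c : R) u v y : br_g s (c *: u + v) y = c *: br_g s u y + br_g s v y.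
Proof.
apply: vec_eq => n hn; rewrite coD coZ !co_br_g // /brg_coords !coD !coZ.
by move: n hn; do 7 (case; [move=> _ /=; ring | ]).
Qed.

Lemma br_g_linr (s c : R) u v y : br_g s y (c *: u + v) = c *: br_g s y u + br_g s y v.
Proof.
apply: vec_eq => n hn; rewrite coD coZ !co_br_g // /brg_coords !coD !coZ.
by move: n hn; do 7 (case; [move=> _ /=; ring | ]).
Qed.

Lemma lin_brl (s : R) f y : lin f -> lin (fun v => f (br_g s v y)).
Proof. by move=> lf c u v; rewrite br_g_linl lf. Qed.

Lemma lin_brr (s : R) f y : lin f -> lin (fun v => f (br_g s y v)).
Proof. by move=> lf c u v; rewrite br_g_linr lf. Qed.

Lemma nth_bump_cat (T : Type) (z w : T) (p q : seq T) i :
  nth z (p ++ w :: q) (bump (size p) i) = nth z (p ++ q) i.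
Proof.
rewrite !nth_cat /bump; case: (leqP (size p) i) => h; last by rewrite add0n h.
by rewrite add1n ltnNge leqW //= subSn // ltnNge h.
Qed.

Lemma vol_lin xs ys : (size xs < 7)%N -> lin (fun v => vol (xs ++ v :: ys)).
Proof.
move=> sx c u v.
transitivity (c * vol (xs ++ u :: ys) + 1 * vol (xs ++ v :: ys)); last by rewrite mul1r.
apply: (@determinant_multilinear _ _ _ _ _ (Ordinal sx)).
- by apply/rowP => j; rewrite !mxE /= !nth_cat ltnn subnn /= !mxE mul1r.
- by apply/matrixP => i j; rewrite !mxE /= !nth_bump_cat.
- by apply/matrixP => i j; rewrite !mxE /= !nth_bump_cat.
Qed.

Lemma size_basis_seq k (f : {ffun 'I_k -> 'I_7}) : size (basis_seq R f) = k.
Proof. by rewrite size_map size_enum_ord. Qed.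

(** The arguments of [hodge a] enter only through [vol], because [a] is evaluated on basis vectors;
    linearity is that of the determinant in a row. *)
Lemma hodge_lin a xs ys : (size xs + size ys < 7)%N ->
  lin (fun v => hodge a (xs ++ v :: ys)).
Proof.
move=> sxy c u v; rewrite /hodge !size_cat /= mulrCA -mulrDr; congr (_ * _).
rewrite mulr_sumr -big_split; apply: eq_bigr => f _ /=.
rewrite !catA vol_lin; first by rewrite mulrDr mulrCA.
by rewrite size_cat size_basis_seq; lia.
Qed.

End Linear.


(** * Exterior derivative and Hodge star on basis vectors *)

Section FormModels.
Variables (R : realType) (s : R).
Implicit Types (a : Defs.form R) (c : iform) (l : seq nat).

Definition evecs l : seq (vec R) := [seq e_nat R i | i <- l].

Definition fmodels k a c : Prop := forall l, valid k l -> a (evecs l) = pev s (c l).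

Lemma fmodels_memo k a c : fmodels k a c -> fmodels k a (memo k c).
Proof. by move=> h l hl; rewrite memoE // h. Qed.

Lemma drop2_evecs i j l : drop2 i j (evecs l) = evecs (idrop2 i j l).
Proof.
rewrite /drop2 /idrop2 /evecs -map_comp size_map; apply/eq_in_map => k.
by rewrite mem_filter mem_iota => /andP[_ hk]; rewrite /= (nth_map 0%N).
Qed.

Lemma valid_idrop2 k i j l : (i < j)%N -> (j < k.+2)%N -> valid k.+2 l ->
  valid k (idrop2 i j l).
Proof.
move=> ij jk /andP[/eqP sl hl]; rewrite /valid size_map; apply/andP; split; last first.
  rewrite all_map; apply/allP => m; rewrite mem_filter mem_iota => /andP[_ hm] /=.
  by rewrite (allP hl) // mem_nth.
rewrite sl size_filter; apply/eqP; move En: k.+2 jk => n jk.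
(* The remaining positions are counted through their complement, the disjoint union of [i] and
   [j]. *)
have := count_predC (fun m => (m != i) && (m != j)) (iota 0 n).
rewrite size_iota.
rewrite (@eq_count _ (predC _) (predU (pred1 i) (pred1 j))); last first.
  by move=> m /=; rewrite negb_and !negbK.
have := count_predUI (pred1 i) (pred1 j) (iota 0 n).
rewrite !(count_uniq_mem _ (iota_uniq _ _)) !mem_iota /=.
rewrite (@eq_count _ (predI _ _) pred0) ?count_pred0; last first.
  by move=> m /=; case: eqP => //= ->; apply/eqP; lia.
have -> : (i < 0 + n)%N by lia.
have -> : (j < 0 + n)%N by lia.
move=> /= hU hC.
by lia.
Qed.

(** In every term of the differential the bracket is the first argument, so linearity there allows
    its expansion; the other arguments are already basis vectors. *)
Lemma fmodels_ext_d k a c :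
  (forall xs, size xs = k -> lin (fun v => a (v :: xs))) ->
  fmodels k.+1 a c -> fmodels k.+2 (ext_d (br_g s) a) (pext_d c).
Proof.
move=> la hac l hl; have /andP[/eqP sl al] := hl.
have nl i : (i < k.+2)%N -> (nth 0%N l i < 7)%N.
  by move=> hi; rewrite (allP al) // mem_nth ?sl.
rewrite /ext_d /pext_d /evecs size_map sl pev_sum.
rewrite -[iota 0 k.+2]/(index_iota 0 k.+2) big_mkord.
apply: eq_bigr => i _; rewrite pev_sum big_filter big_mkord.
apply: eq_bigr => j ij; rewrite pev_sign signr_odd; congr (_ * _).
rewrite pev_sum -[iota 0 7]/(index_iota 0 7) big_mkord.
rewrite !(nth_map 0%N) ?sl //.
rewrite (lin_expand _ (la _ _)); last first.
  rewrite drop2_evecs size_map.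
  by have /andP[/eqP] := valid_idrop2 ij (ltn_ord j) hl.
apply: eq_bigr => m _; rewrite co_ord.
rewrite (models_br (models_base s (nl i _)) (models_base s (nl j _))) //.
rewrite -[m in pco _ m]/(val m).
case: nilP => [->|_]; first by rewrite mul0r.
rewrite pevM; congr (_ * _).
rewrite -e_nat_ord drop2_evecs -hac //.
have /andP[/eqP e1 e2] := valid_idrop2 ij (ltn_ord j) hl.
by rewrite /valid /= e1 eqxx ltn_ord.
Qed.

Lemma vol_evecs l : valid 7 l -> uniq l -> vol (evecs l) = (-1) ^+ parity 7 l.
Proof.
move=> /andP[/eqP sl al] ul; rewrite -det_parity //; congr (\det _).
apply/matrixP => i j; rewrite !mxE (nth_map 0%N) ?sl // co_ord co_e_nat //.
by rewrite (allP al) // mem_nth ?sl.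
Qed.

Lemma vol_evecs_dup k (f : {ffun 'I_k -> 'I_7}) p l :
  (size p + k + size l = 7)%N -> ~~ uniq (p ++ l) ->
  vol (evecs p ++ basis_seq R f ++ evecs l) = 0.
Proof.
move=> sz; apply: contraNeq => h; apply: (@map_uniq _ _ (e_nat R)).
have : uniq (evecs p ++ basis_seq R f ++ evecs l).
  apply: contraNT h => h; rewrite vol_dup //.
  by rewrite !size_cat size_basis_seq !size_map addnA.
apply: subseq_uniq; rewrite map_cat; apply: cat_subseq => //.
exact: suffix_subseq.
Qed.

Lemma sum_basis_seq0 (F : seq (vec R) -> R) :
  \sum_(f : {ffun 'I_0 -> 'I_7}) F (basis_seq R f) = F [::].
Proof.
rewrite (eq_bigr (fun _ => F [::])) => [|f _]; last first.
  by rewrite [basis_seq _ _]size0nil ?size_basis_seq.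
by rewrite sumr_const card_ffun !card_ord expn0.
Qed.

(** A function on $k+1$ indices amounts to its value at the first one and its restriction to the
    rest; [h] and [h'] are the two directions of this bijection. *)
Lemma sum_basis_seqS k (F : seq (vec R) -> R) :
  \sum_(f : {ffun 'I_k.+1 -> 'I_7}) F (basis_seq R f) =
  \sum_(i < 7) \sum_(g : {ffun 'I_k -> 'I_7}) F (e_nat R i :: basis_seq R g).
Proof.
rewrite pair_big /=.
pose h (p : 'I_7 * {ffun 'I_k -> 'I_7}) : {ffun 'I_k.+1 -> 'I_7} :=
  [ffun i => if unlift ord0 i is Some j then p.2 j else p.1].
pose h' (f : {ffun 'I_k.+1 -> 'I_7}) : 'I_7 * {ffun 'I_k -> 'I_7} :=
  (f ord0, [ffun j => f (lift ord0 j)]).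
rewrite (reindex h) /=; last first.
  exists h' => [[i g]|f] _; rewrite /h /h' /=.
    congr (_, _); first by rewrite ffunE unlift_none.
    by apply/ffunP => j; rewrite !ffunE liftK.
  apply/ffunP => j; rewrite !ffunE.
  by case: unliftP => [j' ->|->] //; rewrite ffunE.
apply: eq_bigr => -[i g] _; congr F.
rewrite /basis_seq enum_ordSl /= /h ffunE unlift_none e_nat_ord -map_comp /=.
by congr (_ :: _); apply: eq_map => j /=; rewrite ffunE liftK.
Qed.

(** Induction on the number of indices still to be chosen, for all prefixes [p]: the sum is split
    according to the next index. *)
Lemma phodge_recE a c k p l : fmodels (size p + k) a c ->
  (size p + k + size l = 7)%N -> all (fun i => i < 7)%N (p ++ l) -> uniq (p ++ l) ->
  pev s (phodge_rec k p c l) =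
  \sum_(f : {ffun 'I_k -> 'I_7})
     a (evecs p ++ basis_seq R f) * vol (evecs p ++ basis_seq R f ++ evecs l).
Proof.
elim: k p => [|k IH] p hac sz hall hu.
  rewrite (sum_basis_seq0 (fun t => a (evecs p ++ t) * vol (evecs p ++ t ++ evecs l))).
  rewrite [phodge_rec _ _ _ _]/= pev_sign cats0 cat0s -map_cat vol_evecs //; last first.
    by rewrite /valid size_cat hall -sz addn0 eqxx.
  rewrite mulrC hac // /valid addn0 eqxx.
  by move: hall; rewrite all_cat => /andP[].
rewrite (sum_basis_seqS _ (fun t => a (evecs p ++ t) * vol (evecs p ++ t ++ evecs l))).
rewrite -[phodge_rec _ _ _ _]/(psum
  [seq phodge_rec k (rcons p i) c l | i <- iota 0 7 & i \notin p ++ l]).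
rewrite pev_sum big_filter -[iota 0 7]/(index_iota 0 7) big_mkord.
(* An index already in [p ++ l] repeats a vector in the volume form and contributes 0. *)
rewrite [RHS](bigID (fun i : 'I_7 => val i \notin p ++ l)) /=.
rewrite [X in _ + X]big1 ?addr0; last first.
  move=> i; rewrite negbK => hi; apply: big1 => g _.
  have -> : evecs p ++ (e_nat R i :: basis_seq R g) ++ evecs l =
            evecs (rcons p i) ++ basis_seq R g ++ evecs l.
    by rewrite /evecs map_rcons cat_rcons.
  rewrite vol_evecs_dup ?mulr0 ?size_rcons -?sz; [by [] | by lia |].
  by rewrite cat_rcons uniq_catC /= mem_cat orbC -mem_cat hi.
apply: eq_bigr => i hi; rewrite IH.
- apply: eq_bigr => g _.
  by rewrite /evecs map_rcons !cat_rcons.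
- by rewrite size_rcons addSnnS.
- by rewrite size_rcons -sz; lia.
- by rewrite cat_rcons all_cat /= ltn_ord -all_cat.
- by rewrite cat_rcons uniq_catC /= mem_cat orbC -mem_cat hi uniq_catC.
Qed.

End FormModels.


(** * The soliton equations *)

Definition pe3 (i j k : nat) : iform := fun l =>
  let x := pdelta (nth 0%N l 0) in
  let y := pdelta (nth 0%N l 1) in
  let z := pdelta (nth 0%N l 2) in
  let m u v := psub (pmul (y u) (z v)) (pmul (y v) (z u)) in
  padd (psub (pmul (x i) (m j k)) (pmul (x j) (m i k))) (pmul (x k) (m i j)).

Definition pphi : iform := fun l =>
  psub (psub (psub (padd (padd (padd (pe3 0 1 6 l) (pe3 2 3 6 l)) (pe3 4 5 6 l))
    (pe3 0 2 4 l)) (pe3 0 3 5 l)) (pe3 1 2 5 l)) (pe3 1 3 4 l).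

(** The tables hold $*\varphi$, $d^*\varphi$ and $*d\varphi$, of degrees 4, 2 and 3. The sign
    $(-1)^k$ of the codifferential is $-1$ on 3-forms and $+1$ on 4-forms. *)
Definition plaplacian3 (c : iform) : iform :=
  let hc := memo 4 (phodge c) in
  let cod := memo 2 (fun l => psign true (phodge (pext_d hc) l)) in
  let hd := memo 3 (phodge (pext_d c)) in
  fun l => padd (pext_d cod l) (phodge (pext_d hd) l).

Definition pc_sol : ratpoly := [:: (-15)#8; 0#1; 8#1]%Q.

Definition pD_sol (n : nat) : ratpoly :=
  pco [:: [:: 45#32; (-1)#1; (-2)#1]; [:: 5#32; (-1)#1; (-2)#1];
          [:: 45#32; 1#1; (-2)#1]; [:: 5#32; 1#1; (-2)#1];
          [:: 50#32; 0#1; (-4)#1]; [:: 90#32; 0#1; (-4)#1]]%Q n.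

(** As $D_s$ is diagonal, $\mathcal L_{X_D}\varphi$ on $(e_i, e_j, e_k)$ is $(d_i + d_j +
    d_k)\,\varphi(e_i, e_j, e_k)$, which makes the soliton equation a scalar identity for each
    triple. *)
Definition psoliton_defect (c L : iform) (i j k : nat) : ratpoly :=
  psub (L [:: i; j; k])
    (pmul (padd pc_sol (padd (pD_sol i) (padd (pD_sol j) (pD_sol k))))
       (c [:: i; j; k])).

Lemma psoliton_check : let c := memo 3 pphi in let L := plaplacian3 c in
  all (fun i => all (fun j => all (fun k => pisZ (psoliton_defect c L i j k))
    (iota 0 7)) (iota 0 7)) (iota 0 7).
Proof. by vm_compute. Qed.

Section Soliton.
Variables (R : realType) (s : R).
Implicit Types (a : Defs.form R) (c : iform) (l : seq nat) (x y z v : vec R).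

Lemma Q2R_inv_nat n : (0 < n)%N -> Q2R R (Qmake 1 (Pos.of_nat n)) = n%:R^-1.
Proof.
move=> n0; rewrite /Q2R /= /Z2R /= Nat2Pos.id ?mul1r //.
by case: n n0.
Qed.

Lemma fmodels_hodge k a c : (k <= 7)%N ->
  fmodels s k a c -> fmodels s (7 - k) (hodge a) (phodge c).
Proof.
move=> hk hac l /andP[/eqP sl al]; rewrite /hodge /phodge size_map sl subKn //.
case: ifP => ul.
  rewrite pevZ Q2R_inv_nat ?fact_gt0 //; congr (_ * _).
  by rewrite (@phodge_recE _ s a) // sl subnKC.
(* A repeated index in [l] makes every volume vanish, in agreement with the value [[::]]. *)
rewrite big1 ?mulr0 // => f _.
by rewrite (@vol_evecs_dup R k f [::] l) ?mulr0 ?ul // sl add0n subnKC.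
Qed.

Lemma e3E (i j k : 'I_7) x y z : e3 i j k [:: x; y; z] =
  x 0 i * (y 0 j * z 0 k - y 0 k * z 0 j) - x 0 j * (y 0 i * z 0 k - y 0 k * z 0 i)
  + x 0 k * (y 0 i * z 0 j - y 0 j * z 0 i).
Proof.
rewrite /e3 (expand_det_row _ ord0) !big_ord_recl big_ord0 /cofactor.
rewrite !(expand_det_row _ ord0) !big_ord_recl !big_ord0 /cofactor !det_mx11 !mxE /=.
by rewrite /tnth /=; ring.
Qed.

Lemma phiG2_lin1 y z : lin (fun v => @phiG2 R [:: v; y; z]).
Proof. by move=> c u v; rewrite /phiG2 !e3E !mxE; ring. Qed.

Lemma phiG2_lin2 x z : lin (fun v => @phiG2 R [:: x; v; z]).
Proof. by move=> c u v; rewrite /phiG2 !e3E !mxE; ring. Qed.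

Lemma phiG2_lin3 x y : lin (fun v => @phiG2 R [:: x; y; v]).
Proof. by move=> c u v; rewrite /phiG2 !e3E !mxE; ring. Qed.

Lemma fmodels_e3 i j k : (i < 7)%N -> (j < 7)%N -> (k < 7)%N ->
  fmodels s 3 (e3 (inord i) (inord j) (inord k)) (pe3 i j k).
Proof.
move=> hi hj hk [|p [|q [|r [|? ?]]]] // /and5P[_ hp hq hr _].
by rewrite e3E -!/(co _ _) !co_e_nat // /pe3 !(pevD, pevB, pevM, pev_delta).
Qed.

Lemma fmodels_phi : fmodels s 3 (@phiG2 R) pphi.
Proof.
by move=> l hl; rewrite /phiG2 !(fmodels_e3 _ _ _ hl) // /pphi !(pevD, pevB).
Qed.

Lemma fmodels_laplacian3 a c :
  (forall xs, size xs = 2%N -> lin (fun v => a (v :: xs))) -> fmodels s 3 a c ->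
  fmodels s 3 (hodge_laplacian (br_g s) 3 a) (plaplacian3 c).
Proof.
move=> la hac l hl; rewrite /hodge_laplacian /plaplacian3 pevD; congr (_ + _).
  apply: fmodels_ext_d hl => [xs sx|].
    by apply: linZ; apply: (@hodge_lin _ _ [::]); rewrite sx.
  apply: fmodels_memo => l' hl'; rewrite pev_sign /codiff -signr_odd; congr (_ * _).
  apply: (@fmodels_hodge 5) hl' => //; apply: fmodels_ext_d => [xs sx|].
    by apply: (@hodge_lin _ _ [::]); rewrite sx.
  by apply: fmodels_memo; apply: (@fmodels_hodge 3).
rewrite /codiff -signr_odd mul1r.
apply: (@fmodels_hodge 4) hl => //; apply: fmodels_ext_d => [xs sx|].
  by apply: (@hodge_lin _ _ [::]); rewrite sx.
by apply: fmodels_memo; apply: (@fmodels_hodge 4) => //; apply: fmodels_ext_d.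
Qed.

Lemma phiG2_lin xs : size xs = 2%N -> lin (fun v => @phiG2 R (v :: xs)).
Proof. by case: xs => [|y [|z [|? ?]]] // _; apply: phiG2_lin1. Qed.

Lemma pev_c_sol : pev s pc_sol = c_sol s.
Proof. by rewrite /= /Q2R /Z2R /= /Pos.to_nat /= /c_sol; field. Qed.

Definition D_row : vec R := \row_n pev s (pD_sol n).

Lemma D_solE : D_sol s = diag_mx D_row.
Proof.
congr diag_mx; apply/rowP => i; rewrite !mxE.
case: i => n hn /=; move: n hn.
by do 7 (case; [by rewrite /= /Q2R /Z2R /= /Pos.to_nat /= => _; field | ]).
Qed.

Lemma co_D_row n : (n < 7)%N -> co D_row n = pev s (pD_sol n).
Proof. by move=> hn; rewrite /co mxE inordK. Qed.

Lemma D_sol_derivation : is_derivation (br_g s) (D_sol s).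
Proof.
rewrite D_solE; apply: diag_derivation_br_g; rewrite !co_D_row //;
  by rewrite /= /Q2R /Z2R /= /Pos.to_nat /=; field.
Qed.

Lemma lie_deriv3 D a x y z : lie_deriv_XD D a [:: x; y; z] =
  a [:: x *m D; y; z] + (a [:: x; y *m D; z] + a [:: x; y; z *m D]).
Proof. by rewrite /lie_deriv_XD !big_ord_recl big_ord0 /= addr0. Qed.

Lemma ext_d3 a x y z : ext_d (br_g s) a [:: x; y; z] =
  - a [:: br_g s x y; z] + a [:: br_g s x z; y] - a [:: br_g s y z; x].
Proof.
rewrite /ext_d /=; under eq_bigr do rewrite big_mkcond.
by rewrite !big_ord_recl !big_ord0 /drop2 /= /bump /=; ring.
Qed.

Definition defect x y z : R :=
  hodge_laplacian (br_g s) 3 (@phiG2 R) [:: x; y; z]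
  - (c_sol s * phiG2 [:: x; y; z] + lie_deriv_XD (D_sol s) (@phiG2 R) [:: x; y; z]).

Lemma defect_basis (i j k : 'I_7) : defect (ebase R i) (ebase R j) (ebase R k) = 0.
Proof.
(* The summand 0 produces the shape [c *: u + v] on which [lin] rewrites; the extra terms vanish by
   [z1], [z2] and [z3]. *)
have eD (n : 'I_7) : e_nat R n *m D_sol s = pev s (pD_sol n) *: e_nat R n + 0.
  rewrite D_solE addr0; apply: vec_eq => m hm.
  rewrite co_mul_diag coZ co_e_nat // co_D_row // mulrC.
  by case: eqP => [<-|]; rewrite ?mulr0.
have hl : valid 3 [:: val i; val j; val k] by rewrite /valid /= !ltn_ord.
have phim := fmodels_memo fmodels_phi.
have := all_iotaP (all_iotaP (all_iotaP psoliton_check (ltn_ord i)) (ltn_ord j))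
  (ltn_ord k).
move=> /(pev_isZ s); rewrite /psoliton_defect pevB pevM.
rewrite -phim // -(fmodels_laplacian3 phiG2_lin phim hl) !pevD pev_c_sol => h.
rewrite /defect -!e_nat_ord lie_deriv3 !eD phiG2_lin1 phiG2_lin2 phiG2_lin3.
have z1 y z : @phiG2 R [:: 0; y; z] = 0 by rewrite /phiG2 !e3E !mxE; ring.
have z2 y z : @phiG2 R [:: y; 0; z] = 0 by rewrite /phiG2 !e3E !mxE; ring.
have z3 y z : @phiG2 R [:: y; z; 0] = 0 by rewrite /phiG2 !e3E !mxE; ring.
rewrite z1 z2 z3 -[RHS]h /=; ring.
Qed.

Lemma codiff_lin k a xs ys : (size xs + size ys < 7)%N ->
  lin (fun v => codiff (br_g s) k a (xs ++ v :: ys)).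
Proof. by move=> h; apply: linZ; apply: hodge_lin. Qed.

Lemma codiff_lin21 k a y : lin (fun v => codiff (br_g s) k a [:: v; y]).
Proof. exact: (@codiff_lin _ _ [::]). Qed.

Lemma codiff_lin22 k a x : lin (fun v => codiff (br_g s) k a [:: x; v]).
Proof. exact: (@codiff_lin _ _ [:: x]). Qed.

(** In this expanded form each variable occurs exactly once in every term, in a linear position, so
    trilinearity can be checked term by term. *)
Lemma defectE x y z : defect x y z =
  - codiff (br_g s) 3 (@phiG2 R) [:: br_g s x y; z]
  + codiff (br_g s) 3 (@phiG2 R) [:: br_g s x z; y]
  - codiff (br_g s) 3 (@phiG2 R) [:: br_g s y z; x]
  + codiff (br_g s) 4 (ext_d (br_g s) (@phiG2 R)) [:: x; y; z]
  - (c_sol s * phiG2 [:: x; y; z]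
     + (phiG2 [:: x *m D_sol s; y; z]
        + (phiG2 [:: x; y *m D_sol s; z] + phiG2 [:: x; y; z *m D_sol s]))).
Proof. by rewrite /defect /hodge_laplacian ext_d3 lie_deriv3. Qed.

Lemma defect_lin1 y z : lin (fun v => defect v y z).
Proof.
apply: eq_lin (fun v => defectE v y z) _.
apply: linD; [do 3?apply: linD | apply: linN].
5: apply: linD; [|apply: linD; [|apply: linD]].
- by apply: linN; exact: (lin_brl _ _ (codiff_lin21 _ _ _)).
- exact: (lin_brl _ _ (codiff_lin21 _ _ _)).
- exact/linN/codiff_lin22.
- exact: (@codiff_lin _ _ [::]).
- exact/linZ/phiG2_lin1.
- exact: (lin_comp_mulmx _ (phiG2_lin1 _ _)).
- exact: phiG2_lin1.
- exact: phiG2_lin1.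
Qed.

Lemma defect_lin2 x z : lin (fun v => defect x v z).
Proof.
apply: eq_lin (fun v => defectE x v z) _.
apply: linD; [do 3?apply: linD | apply: linN].
5: apply: linD; [|apply: linD; [|apply: linD]].
- by apply: linN; exact: (lin_brr _ _ (codiff_lin21 _ _ _)).
- exact: codiff_lin22.
- by apply: linN; exact: (lin_brl _ _ (codiff_lin21 _ _ _)).
- exact: (@codiff_lin _ _ [:: x]).
- exact/linZ/phiG2_lin2.
- exact: phiG2_lin2.
- exact: (lin_comp_mulmx _ (phiG2_lin2 _ _)).
- exact: phiG2_lin2.
Qed.

Lemma defect_lin3 x y : lin (fun v => defect x y v).
Proof.
apply: eq_lin (fun v => defectE x y v) _.
apply: linD; [do 3?apply: linD | apply: linN].
5: apply: linD; [|apply: linD; [|apply: linD]].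
- exact/linN/codiff_lin22.
- exact: (lin_brr _ _ (codiff_lin21 _ _ _)).
- by apply: linN; exact: (lin_brr _ _ (codiff_lin21 _ _ _)).
- exact: (@codiff_lin _ _ [:: x; y]).
- exact/linZ/phiG2_lin3.
- exact: phiG2_lin3.
- exact: phiG2_lin3.
- exact: (lin_comp_mulmx _ (phiG2_lin3 _ _)).
Qed.

(** The defect is trilinear, so its vanishing on basis triples suffices. *)
Lemma laplacian_soliton_br_g :
  laplacian_soliton (br_g s) (@phiG2 R) (c_sol s) (D_sol s).
Proof.
split=> [|x y z]; first exact: D_sol_derivation.
apply/eqP; rewrite -subr_eq0 -/(defect x y z); apply/eqP.
apply: (lin_basis0 (defect_lin1 y z)) => i.
apply: (lin_basis0 (defect_lin2 _ z)) => j.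
by apply: (lin_basis0 (defect_lin3 _ _)) => k; apply: defect_basis.
Qed.

End Soliton.

(** * Soliton types and conclusion *)

Theorem theorem4p9 (R : realType) :
  (forall s : R, 0 <= s ->
     (* (i) Laplacian soliton with constant c_s and derivation D_s *)
     (laplacian_soliton (br_g s) (@phiG2 R) (c_sol s) (D_sol s)
      /\ (s < Num.sqrt 15 / 8 -> c_sol s < 0)
      /\ (s = Num.sqrt 15 / 8 -> c_sol s = 0)
      /\ (Num.sqrt 15 / 8 < s -> 0 < c_sol s))
     (* (ii) expanding Ricci soliton iff s = 5/8 *)
     /\ (expanding_ricci_soliton (br_g s) <-> s = 5 / 8))
  /\
  (* (iii) g_s and s_a are never isomorphic *)
  (forall a s : R, ~ lie_isomorphic (br_g s) (br_s a)).
Proof.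
split=> [s s0|a s]; last exact: g_s_not_isomorphic.
split; last exact: expanding_ricci_soliton_br_g.
split; first exact: laplacian_soliton_br_g.
(* Since $c_s = 8(s^2 - 15/64)$ and $s \ge 0$, the sign of $c_s$ is that of $s - \sqrt{15}/8$. *)
have r0 : 0 <= Num.sqrt 15 :> R := sqrtr_ge0 _.
have r2 : Num.sqrt 15 ^+ 2 = 15 :> R by rewrite sqr_sqrtr.
rewrite /c_sol; split; [|split] => hs; first by nra.
  by rewrite hs expr_div_n r2; field.
by nra.
Qed.
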